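(* Fix any $\epsilon>0$ (and any $\beta\in(0,\tfrac12)$). The following algorithm is $(4\epsilon,0)$-differentially private with respect to edge-level neighboring graphs. On input a weighted graph $G=(V,E,w)$ on $n$ vertices with $w\in\mathbb{R}_+^N$ and $m=|E|$: (1) set $\widehat m\leftarrow\min\{N,\lceil m+Z_0+\log(1/\beta)/\epsilon\rceil\}$ with $Z_0\sim\mathrm{Lap}(1/\epsilon)$; (2) sample $\widehat E\subseteq[N]$ with $|\widehat E|=\widehat m$ from the distribution $\pi(S)\propto\prod_{e\in S}\exp(\epsilon w_e)$ over subsets $S\subseteq[N]$ of size $\widehat m$; (3) for each $e\in\widehat E$, draw an independent $Z_e\sim\mathrm{Lap}(1/\epsilon)$ and set $\widehat w_e\leftarrow\max\{0,w_e+Z_e\}$; for $e\notin\widehat E$ set $\widehat w_e\leftarrow 0$; (4) output $\widehat G=(V,\widehat E,\widehat w)$.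
   Context: $N=\binom n2$ and unordered pairs of distinct vertices are identified with $[N]$; a weighted graph $G=(V,E,w)$ is identified with $w\in\mathbb{R}_+^N$, $E=\{e:w_e\neq 0\}$. $\mathrm{Lap}(b)$ is the Laplace distribution with density $\frac{1}{2b}e^{-|x|/b}$. Two graphs $w,w'\in\mathbb{R}_+^N$ are neighboring if $\|w-w'\|_0\le 1$ and $\|w-w'\|_\infty\le 1$. A randomized algorithm $\mathcal{A}$ is $(\epsilon,\delta)$-differentially private if for all neighboring $w,w'$ and all measurable sets $S$ of outputs, $\Pr[\mathcal{A}(w)\in S]\le e^{\epsilon}\Pr[\mathcal{A}(w')\in S]+\delta$.
   Formalization: Since Z_0 is unbounded below, m-hat can be negative, in which case no subset of size m-hat exists and step (2) is undefined; the formal statement samples a set of size max{0, m-hat}, i.e. the empty set in that case. *)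

(* Defs.v *)
From HB Require Import structures.
From mathcomp Require Import all_boot all_order all_algebra.
From mathcomp Require Import all_classical all_reals all_analysis.
From mathcomp Require Import measurable_realfun giry.

Set Implicit Arguments.
Unset Strict Implicit.
Unset Printing Implicit Defensive.
Import Order.TTheory GRing.Theory Num.Theory.
Import numFieldNormedType.Exports.

Local Open Scope classical_set_scope.
Local Open Scope ring_scope.

Section finset_measurable.
Variable T : finType.

HB.instance Definition _ := isPointed.Build {set T} finset.set0.

HB.instance Definition _ := @isMeasurable.Build default_measure_display
  {set T} discrete_measurable discrete_measurable0
  discrete_measurableC discrete_measurableU.

End finset_measurable.

Lemma measurable_fun_finset (T : finType) d (Y : measurableType d)
  (f : {set T} -> Y) : measurable_fun [set: {set T}] f.
Proof. by []. Qed.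

Lemma measurable_fun_nat d (Y : measurableType d) (f : nat -> Y) :
  measurable_fun [set: nat] f.
Proof. by []. Qed.

Section laplace_pdf.
Context {R : realType}.
Variable b : {posnum R}.
Notation mu := lebesgue_measure.

Definition laplace_pdf (x : R) : R :=
  (2 * b%:num)^-1 * expR (- (`|x| / b%:num)).

Lemma laplace_pdf_ge0 x : 0 <= laplace_pdf x.
Proof. by rewrite mulr_ge0 ?expR_ge0. Qed.

Lemma continuous_laplace_pdf : continuous laplace_pdf.
Proof.
move=> x; apply: cvgM; first exact: cvg_cst.
apply: (cvg_comp _ expR); last exact: continuous_expR.
apply: (@cvgN _ R^o); apply: cvgM; last exact: cvg_cst.
exact: (@norm_continuous _ R^o).
Qed.

Lemma measurable_laplace_pdf : measurable_fun [set: R] laplace_pdf.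
Proof.
apply: continuous_measurable_fun.
exact: continuous_laplace_pdf.
Qed.

Lemma integral_laplace_pdf : (\int[mu]_x (laplace_pdf x)%:E = 1)%E.
Proof.
rewrite ge0_symfun_integralT; last 3 first.
- exact: laplace_pdf_ge0.
- exact: continuous_laplace_pdf.
- by move=> x; rewrite /laplace_pdf /= normrN.
have b0 : 0 < b%:num^-1 :> R by [].
have pdfE (x : R) : 0 <= x ->
    laplace_pdf x = 2^-1 * exponential_pdf b%:num^-1 x.
  move=> x0; rewrite exponential_pdfE// /laplace_pdf ger0_norm// invfM.
  by rewrite mulrA [in RHS]mulNr [x / _]mulrC.
have mexp : measurable_fun [set: R]
    (EFin \o exponential_pdf b%:num^-1).
  by apply/measurable_EFinP; exact: measurable_exponential_pdf.
have pos : [set x : R | 0 <= x] = `[0, +oo[%classic.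
  by apply/seteqP; split => x /=; rewrite in_itv/= andbT.
have mpos : measurable [set x : R | 0 <= x] by rewrite pos.
transitivity (2%:E * \int[mu]_(x in [set x : R | (0 <= x)%R])
    ((2^-1)%:E * (exponential_pdf b%:num^-1 x)%:E))%E.
  congr (_ * _)%E; apply: eq_integral => x; rewrite inE/= => x0.
  by rewrite pdfE.
rewrite ge0_integralZl//; first last.
- by move=> x _; rewrite lee_fin exponential_pdf_ge0// ltW.
- exact: measurable_funTS.
rewrite muleA -EFinM mulfV// mul1e -[RHS](integral_exponential_pdf b0).
rewrite integral_mkcond; apply: eq_integral => x _; rewrite patchE.
case: ifPn => //; rewrite notin_setE/= => /negP; rewrite -ltNge => x0.
by rewrite lt0_exponential_pdf.
Qed.

End laplace_pdf.

Definition laplace_prob {R : realType} (b : {posnum R}) : set R -> \bar R :=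
  fun V => (\int[lebesgue_measure]_(x in V) (laplace_pdf b x)%:E)%E.

Section laplace_prob.
Context {R : realType}.
Variable b : {posnum R}.
Local Notation laplace := (laplace_prob b).

Let laplace0 : laplace set0 = 0%E.
Proof. by rewrite /laplace_prob integral_set0. Qed.

Let laplace_ge0 A : (0 <= laplace A)%E.
Proof.
by rewrite /laplace_prob integral_ge0//= => x _; rewrite lee_fin laplace_pdf_ge0.
Qed.

Let laplace_sigma_additive : semi_sigma_additive laplace.
Proof.
move=> /= F mF tF mUF; rewrite /laplace_prob; apply: cvg_toP.
  apply: ereal_nondecreasing_is_cvgn => m n mn.
  apply: lee_sum_nneg_natr => // k _ _; apply: integral_ge0 => /= x Fkx.
  by rewrite lee_fin laplace_pdf_ge0.
rewrite ge0_integral_bigcup//=.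
- by apply/measurable_funTS/measurable_EFinP; exact: measurable_laplace_pdf.
- by move=> x _; rewrite lee_fin laplace_pdf_ge0.
Qed.

HB.instance Definition _ := isMeasure.Build _ _ _
  laplace laplace0 laplace_ge0 laplace_sigma_additive.

Let laplace_setT : laplace [set: R] = 1%E.
Proof. by rewrite /laplace_prob integral_laplace_pdf. Qed.

HB.instance Definition _ :=
  @Measure_isProbability.Build _ _ R laplace laplace_setT.

End laplace_prob.

Section prob_bind.
Context d1 d2 (X : measurableType d1) (Y : measurableType d2) (R : realType).
Variables (P : probability X R) (k : X -> probability Y R).
Hypothesis mk : measurable_fun [set: X] (k : X -> giry Y R).

Definition prob_bind : set Y -> \bar R := giry_bind (P : giry X R) mk.

Lemma prob_bindE A : measurable A -> prob_bind A = (\int[P]_x k x A)%E.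
Proof.
move=> mA; rewrite /prob_bind /giry_bind/=.
by rewrite giry_int_map//; exact: measurable_giry_ev.
Qed.

HB.instance Definition _ := Measure.on prob_bind.

Let prob_bind_setT : prob_bind [set: Y] = 1%E.
Proof.
rewrite prob_bindE//; under eq_integral do rewrite probability_setT.
by rewrite integral_cst// mul1e; exact: probability_setT.
Qed.

HB.instance Definition _ :=
  Measure_isProbability.Build _ _ R prob_bind prob_bind_setT.

End prob_bind.

Section tuple_prob.
Context d (T : measurableType d) (R : realType).

Definition cons_pair n (x : T * n.-tuple T) : n.+1.-tuple T :=
  [tuple of x.1 :: x.2].

Let measurable_cons_pair n : measurable_fun setT (@cons_pair n).
Proof. exact: measurable_cons. Qed.

HB.instance Definition _ n :=
  isMeasurableFun.Build _ _ _ _ (@cons_pair n) (@measurable_cons_pair n).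

(* The law of a tuple of independent components with the given laws. *)
Fixpoint tuple_prob n : ('I_n -> probability T R) -> probability (n.-tuple T) R :=
  match n with
  | 0 => fun=> dirac [tuple]
  | m.+1 => fun P =>
      distribution (P ord0 \x tuple_prob (fun i => P (lift ord0 i)))%E
        (@cons_pair m)
  end.

Lemma tuple_probE n (P : 'I_n -> probability T R) (A : 'I_n -> set T) :
  (forall i, measurable (A i)) ->
  tuple_prob P [set t | forall i, A i (tnth t i)] = (\prod_i P i (A i))%E.
Proof.
elim: n => [|n IH] in P A * => mA.
  by rewrite big_ord0 /= diracE mem_set// => -[].
have mbox : measurable [set t : n.-tuple T | forall i, A (lift ord0 i) (tnth t i)].
  rewrite (_ : mkset _ =
      \bigcap_(i in [set: 'I_n]) (@tnth n T ^~ i @^-1` A (lift ord0 i))).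
    apply: fin_bigcap_measurable => // i _; rewrite -[X in measurable X]setTI.
    exact: measurable_tnth.
  by apply/seteqP; split => t /= h i => [_|]; exact: h.
rewrite big_ord_recl /= /distribution /pushforward -IH//.
rewrite -product_measure1E//; congr (_ _).
apply/seteqP; split => -[x t] /=.
  move=> h; split; first by have := h ord0; rewrite tnth0.
  by move=> i; have := h (lift ord0 i); rewrite tnthS.
move=> [Ax At] i; case: (unliftP ord0 i) => [j ->|->]; last by rewrite tnth0.
by rewrite tnthS; exact: At.
Qed.

End tuple_prob.

Section finset_weight.
Context {R : realType} {T : finType}.
Variables (v : T -> R) (k : nat).

Definition finset_weight (A : set {set T}) : \bar R :=
  (\sum_(S : {set T} | #|S| == k) (\prod_(e in S) expR (v e))%:E * \d_S A)%E.

Let finset_weight0 : finset_weight set0 = 0%E.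
Proof. by rewrite /finset_weight big1// => S _; rewrite measure0 mule0. Qed.

Let prod_ge0 (S : {set T}) : (0 <= (\prod_(e in S) expR (v e))%:E)%E.
Proof. by rewrite lee_fin prodr_ge0// => e _; exact: expR_ge0. Qed.

Let finset_weight_ge0 A : (0 <= finset_weight A)%E.
Proof. by apply: sume_ge0 => S _; rewrite mule_ge0. Qed.

Let finset_weight_sigma_additive : semi_sigma_additive finset_weight.
Proof.
move=> F mF tF mUF; rewrite /finset_weight.
rewrite (_ : (fun n => _) = (fun n => \sum_(S : {set T} | #|S| == k)
    ((\prod_(e in S) expR (v e))%:E * \sum_(0 <= i < n) \d_S (F i)))%E).
  apply: cvg_nnesum => S _.
    by near=> n; rewrite mule_ge0// sume_ge0.
  apply: cvgeZl => //; exact: measure_semi_sigma_additive.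
apply/funext => n; rewrite exchange_big/=; apply: eq_bigr => S _.
by rewrite ge0_sume_distrr.
Unshelve. all: by end_near. Qed.

HB.instance Definition _ := isMeasure.Build _ _ _ finset_weight
  finset_weight0 finset_weight_ge0 finset_weight_sigma_additive.

(* Proportional to [\prod_(e in S) expR (v e)] on the sets [S] of cardinality
   [k]; the Dirac mass only serves when there is no such set. *)
Definition finset_prob : probability {set T} R :=
  mnormalize finset_weight (dirac finset.set0).

End finset_weight.

Section weighted_graphs.
Context {R : realType} {n : nat}.
Local Notation N := 'C(n, 2).

(* The unordered pairs of distinct vertices are identified with ['I_N]. *)
Record wgraph := WGraph {
  weight :> N.-tuple R;
  weight_ge0 : forall e, 0 <= tnth weight e }.

Definition edges (w : N.-tuple R) : {set 'I_N} := [set e | tnth w e != 0]%SET.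

Definition l0norm (v : N.-tuple R) : nat := #|[set e | tnth v e != 0]%SET|.

Definition linfnorm (v : N.-tuple R) : R := \big[Num.max/0]_e `|tnth v e|.

Definition weight_diff (w w' : N.-tuple R) : N.-tuple R :=
  [tuple tnth w e - tnth w' e | e < N].

Definition neighboring (w w' : wgraph) : Prop :=
  (l0norm (weight_diff w w') <= 1)%N /\ linfnorm (weight_diff w w') <= 1.

End weighted_graphs.
Arguments wgraph : clear implicits.

Definition differentially_private (R : realType) (G : Type)
    (nbr : G -> G -> Prop) d (Y : measurableType d)
    (eps delta : R) (A : G -> probability Y R) : Prop :=
  forall g g', nbr g g' -> forall S : set Y, measurable S ->
    (A g S <= (expR eps)%:E * A g' S + delta%:E)%E.

Section noisy_weight.
Context {R : realType}.

Definition noisy_weight (x z : R) : R := Num.max 0 (x + z).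

Let measurable_noisy_weight x : measurable_fun setT (noisy_weight x).
Proof. by apply: measurable_maxr => //; exact: measurable_funD. Qed.

HB.instance Definition _ x :=
  isMeasurableFun.Build _ _ _ _ (noisy_weight x) (measurable_noisy_weight x).

End noisy_weight.

Section private_graph.
Context {R : realType} {n : nat}.
Local Notation N := 'C(n, 2).
Variables (eps : {posnum R}) (beta : R) (w : wgraph R n).

Definition noise_prob : probability R R := laplace_prob (eps%:num^-1)%:pos.

Definition mhat (z : R) : int :=
  Num.min N%:Z (Num.ceil (#|edges w|%:R + z + ln (1 / beta) / eps%:num)).

(* [mhat] may be negative, in which case the sampled edge set is empty. *)
Definition sample_size (z : R) : nat := absz (Num.max 0 (mhat z)).

Let measurable_sample_size : measurable_fun setT sample_size.
Proof.
have mf : measurable_fun setT (fun z : R => (sample_size z)%:R : R).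
  apply: nondecreasing_measurable => // x y xy.
  have ge0 t : 0 <= Num.max 0 (mhat t) by rewrite le_max lexx.
  rewrite ler_nat -lez_nat /sample_size !gez0_abs//.
  apply: le_max2 => //; apply: le_min2 => //.
  by apply: ceil_le; rewrite !lerD2r lerD2l.
move=> _ B _; rewrite setTI.
rewrite (_ : _ @^-1` _ =
    \bigcup_(k in B) ((fun z : R => (sample_size z)%:R : R) @^-1` [set k%:R])).
  apply: bigcup_measurable => k _; rewrite -[X in measurable X]setTI.
  exact: mf.
apply/seteqP; split => [z Bz|z [k Bk /= /eqP]]; first by exists (sample_size z).
by rewrite eqr_nat => /eqP ->.
Qed.

HB.instance Definition _ :=
  isMeasurableFun.Build _ _ _ _ sample_size measurable_sample_size.

Definition size_prob : probability nat R :=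
  distribution noise_prob sample_size.

Definition edges_prob (k : nat) : probability {set 'I_N} R :=
  finset_prob (fun e => eps%:num * tnth w e) k.

Definition weights_prob (E : {set 'I_N}) : probability (N.-tuple R) R :=
  tuple_prob (fun e =>
    if e \in E
    then distribution noise_prob (noisy_weight (tnth w e))
         : probability R R
    else dirac (0 : R)).

Definition output_prob (E : {set 'I_N}) :
    probability ({set 'I_N} * N.-tuple R)%type R :=
  (dirac E \x weights_prob E)%E.

Definition private_graph : probability ({set 'I_N} * N.-tuple R)%type R :=
  prob_bind size_prob (k := fun k =>
    prob_bind (edges_prob k) (k := output_prob) (measurable_fun_finset _))
    (measurable_fun_nat _).

End private_graph.

(* Main.v *)
Require Import Defs.
From HB Require Import structures.
From mathcomp Require Import all_boot all_order all_algebra.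
From mathcomp Require Import all_classical all_reals all_analysis.
From mathcomp Require Import measurable_realfun giry ring lra.
Import Order.TTheory GRing.Theory Num.Theory.
Local Open Scope ring_scope.

(* Say that [mu] has max-divergence at most [r] from [nu] when
   [mu A <= expR r * nu A] for every measurable [A]. Such bounds are preserved
   by pushforwards and add up along binds and products. Neighboring weights are
   at l1-distance at most 1 and their edge counts differ by at most 1, so the
   noisy size costs [eps] (translating a Laplace variable by [a] costs
   [eps * `|a|]), the edge set costs [2 * eps] (its weights and its normalizing
   constant each change by a factor of at most [expR eps]), and the noisy
   weights together cost [eps * \sum_e `|w e - w' e| <= eps]. *)

Set Implicit Arguments.
Unset Strict Implicit.
Unset Printing Implicit Defensive.
Local Open Scope classical_set_scope.

(** * Calculus of max-divergence bounds *)

Definition max_divergence_le (R : realType) d (T : measurableType d) (r : R)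
    (mu nu : set T -> \bar R) : Prop :=
  forall A, measurable A -> (mu A <= (expR r)%:E * nu A)%E.

Section max_divergence.
Context {R : realType}.
Local Open Scope ereal_scope.

Lemma max_divergence_le_refl d (T : measurableType d) (r : R)
    (mu : {measure set T -> \bar R}) : (0 <= r)%R -> max_divergence_le r mu mu.
Proof.
by move=> r0 A mA; rewrite -[leLHS]mul1e lee_wpmul2r// lee_fin -expR0 ler_expR.
Qed.

Lemma max_divergence_le_weaken d (T : measurableType d) (r s : R)
    (mu nu : {measure set T -> \bar R}) : (r <= s)%R ->
  max_divergence_le r mu nu -> max_divergence_le s mu nu.
Proof.
move=> rs munu A mA; apply: (le_trans (munu _ mA)).
by rewrite lee_wpmul2r// lee_fin ler_expR.
Qed.

(** The measure [nu] scaled by [expR r] dominates [mu], and the integral of a nonnegative function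
    is monotone in the measure. *)
Lemma ge0_le_integral_max_divergence d (T : measurableType d) (r : R)
    (mu nu : {measure set T -> \bar R}) (f : T -> \bar R) :
    max_divergence_le r mu nu ->
    (forall x, 0 <= f x) -> measurable_fun [set: T] f ->
  \int[mu]_x f x <= (expR r)%:E * \int[nu]_x f x.
Proof.
move=> munu f0 mf; pose c : {nonneg R} := NngNum (expR_ge0 r).
rewrite -(@ge0_integral_mscale _ _ _ nu _ _ c)//.
exact: ge0_le_measure_integral.
Qed.

(** Changing the measure costs [r] and changing the integrand costs [s]. Binds and products are both
    integrals of this form, so this is their common composition step. *)
Lemma ge0_le_integral_max_divergence2 d (T : measurableType d) (r s : R)
    (mu nu : {measure set T -> \bar R}) (f g : T -> \bar R) :
    max_divergence_le r mu nu ->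
    (forall x, 0 <= f x) -> measurable_fun [set: T] f ->
    (forall x, 0 <= g x) -> measurable_fun [set: T] g ->
    (forall x, f x <= (expR s)%:E * g x) ->
  \int[mu]_x f x <= (expR (r + s))%:E * \int[nu]_x g x.
Proof.
move=> munu f0 mf g0 mg fg.
apply: (le_trans (ge0_le_integral_max_divergence munu f0 mf)).
rewrite expRD EFinM -muleA lee_wpmul2l ?lee_fin ?expR_ge0//.
rewrite -ge0_integralZl//.
by apply: ge0_le_integral => //; exact: measurable_funeM.
Qed.

Lemma max_divergence_le_bind d1 d2 (X : measurableType d1)
    (Y : measurableType d2) (r s : R) (P Q : probability X R)
    (k l : X -> probability Y R)
    (mk : measurable_fun [set: X] (k : X -> giry Y R))
    (ml : measurable_fun [set: X] (l : X -> giry Y R)) :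
    max_divergence_le r P Q -> (forall x, max_divergence_le s (k x) (l x)) ->
  max_divergence_le (r + s) (prob_bind P mk) (prob_bind Q ml).
Proof.
move=> PQ kl A mA; rewrite !prob_bindE//.
apply: ge0_le_integral_max_divergence2 => //.
- exact: (measurableT_comp (measurable_giry_ev mA) mk).
- exact: (measurableT_comp (measurable_giry_ev mA) ml).
- by move=> x; exact: kl.
Qed.

(** The product mass of [A] is the integral over [x] of the mass that the second factor gives to the
    section of [A] at [x]. *)
Lemma max_divergence_le_product d1 d2 (X : measurableType d1)
    (Y : measurableType d2) (r s : R) (P P' : probability X R)
    (Q Q' : probability Y R) :
    max_divergence_le r P P' -> max_divergence_le s Q Q' ->
  max_divergence_le (r + s) (P \x Q) (P' \x Q').
Proof.
move=> PP QQ A mA; apply: ge0_le_integral_max_divergence2 => //.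
- exact: measurable_fun_xsection.
- exact: measurable_fun_xsection.
- by move=> x; apply: QQ; exact: measurable_xsection.
Qed.

Lemma max_divergence_le_distribution d1 d2 (X : measurableType d1)
    (Y : measurableType d2) (r : R) (P Q : probability X R)
    (f : {mfun X >-> Y}) :
  max_divergence_le r P Q ->
  max_divergence_le r (distribution P f) (distribution Q f).
Proof.
move=> PQ A mA; apply: PQ; rewrite -[X in measurable X]setTI.
exact: measurable_funPT.
Qed.

Lemma max_divergence_le_tuple d (T : measurableType d) n (r : 'I_n -> R)
    (P Q : 'I_n -> probability T R) :
    (forall i, max_divergence_le (r i) (P i) (Q i)) ->
  max_divergence_le (\sum_i r i)%R (tuple_prob P) (tuple_prob Q).
Proof.
elim: n => [|n IH] in r P Q * => PQ.
  by rewrite big_ord0; exact: max_divergence_le_refl.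
rewrite big_ord_recl /=; apply: max_divergence_le_distribution.
by apply: max_divergence_le_product => //; apply: IH => i.
Qed.

End max_divergence.

(** * Translates of the Lebesgue measure and of Laplace noise *)

Section laplace_shift.
Context {R : realType}.
Local Notation mu := (@lebesgue_measure R).

(** By uniqueness of the Lebesgue measure, comparing the lengths of half-open intervals suffices. *)
Lemma lebesgue_measure_shift (a : R) (A : set R) : measurable A ->
  pushforward mu (fun x : R => (x + a : measurableTypeR R)) A = mu A.
Proof.
have mshift : measurable_fun [set: R] (fun x : R => x + a : measurableTypeR R).
  exact: measurable_funD.
pose h : {mfun R >-> measurableTypeR R} :=
  HB.pack (fun x : R => x + a : measurableTypeR R)
    (isMeasurableFun.Build _ _ _ _ _ mshift).
move=> mA; apply/esym.
apply: (@lebesgue_measure_unique R (pushforward mu h)) => //= _ [[b c]] _ <-.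
rewrite /pushforward (_ : _ @^-1` _ = `](b - a), (c - a)]%classic).
  rewrite !lebesgue_measure_itv/= !lte_fin ltrD2r.
  by congr (if _ then _ else _); rewrite -!EFinB; congr (_%:E); ring.
by apply/seteqP; split => x /=; rewrite !in_itv/= ltrBlDr lerBrDr.
Qed.

Lemma ge0_integral_shift (a : R) (f : R -> \bar R) (A : set R) :
    measurable A -> measurable_fun [set: R] f -> (forall x, 0 <= f x)%E ->
  (\int[mu]_(x in A) f x =
   \int[mu]_(x in (fun z => z + a)%R @^-1` A) f (x + a)%R)%E.
Proof.
move=> mA mf f0.
have mshift : measurable_fun [set: R] (fun x : R => x + a : measurableTypeR R).
  exact: measurable_funD.
transitivity (\int[pushforward mu
    (fun x : R => x + a : measurableTypeR R)%R]_(x in A) f x)%E.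
  apply: eq_measure_integral => //= B mB BA.
  exact/esym/lebesgue_measure_shift.
rewrite ge0_integral_pushforward//.
exact: measurable_funS mf.
Qed.

(** The triangle inequality [|x| <= |x + a| + |a|], put in the exponent. *)
Lemma laplace_pdf_shift (b : {posnum R}) (a x : R) :
  laplace_pdf b (x + a) <= expR (`|a| / b%:num) * laplace_pdf b x.
Proof.
rewrite /laplace_pdf mulrCA ler_wpM2l// -expRD ler_expR -!mulNr -mulrDl.
rewrite ler_wpM2r//.
by have := ler_normB (x + a) a; rewrite addrK; lra.
Qed.

Lemma laplace_prob_shift (b : {posnum R}) (a : R) (A : set R) : measurable A ->
  (laplace_prob b A <=
   (expR (`|a| / b%:num))%:E * laplace_prob b ((fun z => z + a)%R @^-1` A))%E.
Proof.
move=> mA; have mpdf := measurable_laplace_pdf b.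
have mA' : measurable ((fun z : R => z + a)%R @^-1` A).
  by rewrite -[X in measurable X]setTI; apply: measurable_funD.
rewrite /laplace_prob (@ge0_integral_shift a)//; last 2 first.
- exact/measurable_EFinP.
- by move=> x; rewrite lee_fin laplace_pdf_ge0.
rewrite -ge0_integralZl//; last 2 first.
- exact/measurable_funTS/measurable_EFinP.
- by move=> x _; rewrite lee_fin laplace_pdf_ge0.
apply: ge0_le_integral => //.
- by move=> x _; rewrite lee_fin laplace_pdf_ge0.
- apply/measurable_funTS/measurable_EFinP.
  by apply: measurableT_comp => //; exact: measurable_funD.
- apply/measurable_funTS/measurable_EFinP.
  exact: measurable_funM.
- by move=> x _; rewrite -EFinM lee_fin laplace_pdf_shift.
Qed.

End laplace_shift.

(** Changing the data by [a] before noise is added amounts to translating the noise. As [f] is any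
    measurable function, later rounding or clipping is covered. *)
Lemma max_divergence_le_shift (R : realType) d (Y : measurableType d)
    (eps : {posnum R}) (f g : {mfun R >-> Y}) (a : R) :
    (forall z, g z = f (z + a)) ->
  max_divergence_le (eps%:num * `|a|)
    (distribution (noise_prob eps) f) (distribution (noise_prob eps) g).
Proof.
move=> gf A mA; rewrite /distribution /pushforward.
rewrite (_ : g @^-1` A = (fun z => z + a) @^-1` (f @^-1` A)); last first.
  by apply/seteqP; split => z /=; rewrite gf.
have -> : eps%:num * `|a| = `|a| / (eps%:num^-1)%:pos%:num.
  by rewrite /= invrK mulrC.
apply: laplace_prob_shift; rewrite -[X in measurable X]setTI.
exact: measurable_funPT.
Qed.

(** * Sampling a set of fixed size with product weights *)

Section finset_prob.
Context {R : realType} {T : finType}.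
Implicit Types (v u : T -> R) (k : nat).

(** For each [S] the exponents differ by the sum over [S] of [v e - u e], which the full l1-distance
    bounds. *)
Lemma finset_weight_le v u k (r : R) (A : set {set T}) :
    \sum_e `|v e - u e| <= r ->
  (finset_weight v k A <= (expR r)%:E * finset_weight u k A)%E.
Proof.
move=> vur; rewrite /finset_weight ge0_sume_distrr; last first.
  by move=> S _; rewrite mule_ge0// lee_fin prodr_ge0.
apply: lee_sum => S _; rewrite muleA lee_wpmul2r// -EFinM lee_fin.
rewrite -!expR_sum -expRD ler_expR; apply: le_trans (lerD vur (lexx _)).
rewrite -lerBlDr -sumrB.
apply: (@le_trans _ _ (\sum_(e in S) `|v e - u e|)).
  by apply: ler_sum => e _; exact: ler_norm.
by rewrite [leRHS](bigID (mem S))/= lerDl sumr_ge0.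
Qed.

Lemma finset_weight_setT v k : finset_weight v k [set: {set T}] =
  (\sum_(S : {set T} | #|S| == k) \prod_(e in S) expR (v e))%:E.
Proof.
rewrite /finset_weight -sumEFin; apply: eq_bigr => S _.
by rewrite diracT mule1.
Qed.

Lemma finset_weight_setT_eq0 v u k :
  (finset_weight v k [set: {set T}] == 0%E) =
  (finset_weight u k [set: {set T}] == 0%E).
Proof.
have le0 v' u' : finset_weight u' k [set: {set T}] = 0%E ->
    finset_weight v' k [set: {set T}] = 0%E.
  move=> u0; apply/eqP; rewrite eq_le measure_ge0 andbT.
  have := @finset_weight_le v' u' k _ [set: {set T}] (lexx _).
  by rewrite u0 mule0.
by apply/eqP/eqP; exact: le0.
Qed.

(** The total weight [Z] is a finite sum of reals, so the infinite case of [mnormalize] never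
    arises. *)
Lemma finset_probE v k (A : set {set T}) :
    let Z := \sum_(S : {set T} | #|S| == k) \prod_(e in S) expR (v e) in
  finset_prob v k A =
    if Z == 0 then \d_finset.set0 A else (finset_weight v k A * Z^-1%:E)%E.
Proof.
move=> Z; have ZE : finset_weight v k [set: {set T}] = Z%:E.
  exact: finset_weight_setT.
transitivity (if (finset_weight v k [set: {set T}] == 0%E)
    || (finset_weight v k [set: {set T}] == +oo%E) then \d_finset.set0 A
    else finset_weight v k A *
      (fine (finset_weight v k [set: {set T}]))^-1%:E)%E.
  by rewrite /finset_prob /= /mnormalize /=; case: ifP.
by rewrite ZE eqe orbF.
Qed.

Lemma max_divergence_le_finset v u k (r : R) :
    \sum_e `|v e - u e| <= r ->
  max_divergence_le (2 * r) (finset_prob v k) (finset_prob u k).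
Proof.
move=> vur A mA.
have r0 : 0 <= r by apply: le_trans vur; exact: sumr_ge0.
(* If no set has cardinality [k], both laws are the Dirac mass at the empty set. *)
have [v0|v0] := eqVneq (finset_weight v k [set: {set T}]) 0%E.
  have u0 : finset_weight u k [set: {set T}] = 0%E.
    by apply/eqP; rewrite (finset_weight_setT_eq0 u v) v0.
  move: u0 v0; rewrite !finset_weight_setT => -[u0] [v0].
  rewrite !finset_probE u0 v0 eqxx.
  by apply: (@max_divergence_le_refl _ _ _ _ (\d_finset.set0)) => //; lra.
have uvr : \sum_e `|u e - v e| <= r.
  by under eq_bigr do rewrite distrC.
have pos v' : finset_weight v' k [set: {set T}] != 0%E ->
    0 < \sum_(S : {set T} | #|S| == k) \prod_(e in S) expR (v' e).
  rewrite finset_weight_setT eqe lt_def => -> /=.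
  by apply: sumr_ge0 => S _; apply: prodr_ge0 => e _; rewrite expR_ge0.
have u0 := v0; rewrite (finset_weight_setT_eq0 v u) in u0.
have := finset_weight_le k setT uvr.
rewrite !finset_weight_setT -EFinM lee_fin.
move: {v0}(pos _ v0) {u0}(pos _ u0) => V0 U0.
rewrite !finset_probE !gt_eqF//; move: V0 U0.
set V := \sum_(S | _) _; set U := \sum_(S | _) _ => V0 U0 UV.
(* One factor [expR r] pays for the unnormalized weight of [A]; the other comes from [UV], which
   gives [V^-1 <= expR r * U^-1]. *)
apply: (@le_trans _ _ ((expR r)%:E * finset_weight u k A * V^-1%:E)%E).
  by rewrite lee_wpmul2r ?lee_fin ?invr_ge0 ?(ltW V0)// finset_weight_le.
rewrite (muleC _ V^-1%:E) (muleC (finset_weight u k A)) !muleA.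
rewrite lee_wpmul2r// -!EFinM lee_fin ler_pdivlMr// -mulrA ler_pdivrMl//.
by rewrite mulr_natl mulr2n expRD mulrCA ler_wpM2l ?expR_ge0// mulrC.
Qed.

End finset_prob.

(** * Sensitivity of the weights and of the edge count *)

Section neighboring_graphs.
Context {R : realType} {n : nat}.
Local Notation N := 'C(n, 2).
Implicit Types w : wgraph R n.

Lemma neighboring_eq_off w w' : neighboring w w' ->
  exists A : {set 'I_N}, (#|A| <= 1)%N /\
    forall e, e \notin A -> tnth w e = tnth w' e.
Proof.
move=> [l0 _]; eexists; split; first exact: l0.
by move=> e; rewrite !inE negbK tnth_mktuple subr_eq0 => /eqP.
Qed.

(** At most one term is nonzero, and the sup norm bounds it by 1. *)
Lemma neighboring_l1 w w' : neighboring w w' ->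
  \sum_e `|tnth w e - tnth w' e| <= 1.
Proof.
move=> [l0 linf].
have le1 e : `|tnth w e - tnth w' e| <= 1.
  apply: le_trans linf; rewrite /linfnorm.
  by rewrite (bigD1 e)//= tnth_mktuple le_max lexx.
move: l0; rewrite /l0norm; set A := finset _ => A1.
rewrite (bigID (mem A))/= [X in _ + X]big1 ?addr0; last first.
  by move=> e; rewrite !inE negbK tnth_mktuple => /eqP ->; rewrite normr0.
apply: (@le_trans _ _ (\sum_(e in A) 1)); first exact: ler_sum.
by rewrite sumr_const -[leRHS]/(1%:R) ler_nat.
Qed.

Lemma neighboring_card_edges w w' : neighboring w w' ->
  `|#|edges w|%:R - #|edges w'|%:R| <= 1 :> R.
Proof.
move=> /neighboring_eq_off[A [A1 ww]].
(* Off [A] the supports agree, so [edges u] lies in the union of [edges u'] and [A]. *)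
have le_card u u' : (forall e, e \notin A -> tnth u e = tnth u' e) ->
    (#|@edges R n u| <= #|@edges R n u'| + 1)%N.
  move=> uu; rewrite -(leq_add2l #|edges u'|) in A1.
  apply: leq_trans A1; apply: leq_trans (leq_card_setU _ _).
  apply: subset_leq_card; apply/fintype.subsetP => e; rewrite !inE.
  by case: (boolP (e \in A)) => [|eA]; rewrite ?orbT// orbF uu.
have := le_card w w' ww.
have := le_card w' w (fun e eA => esym (ww e eA)).
by rewrite -!(ler_nat R) !natrD ler_norml => *; apply/andP; split; lra.
Qed.

End neighboring_graphs.

(** * The cost of each stage and the total *)

Section private_graph.
Context {R : realType} {n : nat}.
Local Notation N := 'C(n, 2).
Variables (eps : {posnum R}) (beta : R) (w w' : wgraph R n).
Hypothesis ww' : neighboring w w'.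

(** The edge count is added directly to the noise, so passing from [w] to [w'] translates the noise
    by the difference of the counts. *)
Lemma max_divergence_le_size :
  max_divergence_le eps%:num (size_prob eps beta w) (size_prob eps beta w').
Proof.
apply: (max_divergence_le_weaken (r := eps%:num *
  `|#|edges w'|%:R - #|edges w|%:R|)).
  by rewrite ler_piMr// distrC neighboring_card_edges.
apply: max_divergence_le_shift => z /=; rewrite /sample_size /mhat.
by rewrite (_ : #|edges w|%:R + _ = #|edges w'|%:R + z)//; ring.
Qed.

Lemma max_divergence_le_edges k :
  max_divergence_le (2 * eps%:num) (edges_prob eps w k) (edges_prob eps w' k).
Proof.
apply: max_divergence_le_finset.
under eq_bigr do rewrite -mulrBr normrM gtr0_norm//.
by rewrite -mulr_sumr ler_piMr// neighboring_l1.
Qed.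

(** The set [E] is the same on both sides: a pair in [E] costs [eps] times the change of its weight,
    and the other pairs have the same Dirac law at 0. *)
Lemma max_divergence_le_weights E :
  max_divergence_le eps%:num (weights_prob eps w E) (weights_prob eps w' E).
Proof.
apply: (max_divergence_le_weaken (r := \sum_e
  (eps%:num * `|tnth w' e - tnth w e|))).
  rewrite -mulr_sumr ler_piMr//; under eq_bigr do rewrite distrC.
  exact: neighboring_l1.
apply: max_divergence_le_tuple => e; case: ifPn => _.
  apply: max_divergence_le_shift => z; rewrite /noisy_weight /=.
  by congr (Num.max _ _); ring.
by apply: max_divergence_le_refl; rewrite mulr_ge0.
Qed.

Lemma max_divergence_le_private_graph :
  max_divergence_le (4 * eps%:num)
    (private_graph eps beta w) (private_graph eps beta w').
Proof.
(* The summands are the costs of the size, the edge set, the copy of the edge set in the output, and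
   the noisy weights. *)
have -> : 4 * eps%:num = eps%:num + (2 * eps%:num + (0 + eps%:num)) by ring.
apply: max_divergence_le_bind; first exact: max_divergence_le_size.
move=> k; apply: max_divergence_le_bind; first exact: max_divergence_le_edges.
move=> E; apply: max_divergence_le_product; first exact: max_divergence_le_refl.
exact: max_divergence_le_weights.
Qed.

End private_graph.

Theorem theorem4p1 (R : realType) (n : nat) (eps : {posnum R}) (beta : R)
  (beta_bounds : 0 < beta < 1 / 2) :
  differentially_private (@neighboring R n) (4 * eps%:num) 0
    (private_graph eps beta).
Proof.
move=> w w' ww' S mS; rewrite adde0.
exact: max_divergence_le_private_graph.
Qed.
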